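(* For all $d\ge 2$, $$\mathfrak{c}_d^{\mathrm{cone}}\le \bigl\lceil\sqrt{d-1}\,\bigr\rceil(d-1)\,\frac{d(d+1)}{2}\Bigl(\frac32\Bigr)^{\lceil\sqrt{d-1}\rceil(d-1)-2}.$$
   Context: Cones are subsets of $\mathbb{R}^d$ closed under nonnegative linear combinations; all cones are assumed polyhedral, rational (generated by finitely many rational vectors) and pointed. For such a cone $C$, $\mathrm{Hilb}(C)$ is the unique minimal finite generating set of the semigroup $C\cap\mathbb{Z}^d$. The extreme integral generators of $C$ are the generators of the semigroups $l\cap\mathbb{Z}^d\cong\mathbb{Z}_+$ for the edges $l$ of $C$. $\Delta_C$ is the convex hull of $O$ and the extreme integral generators of $C$. $C$ is simplicial if it has a linearly independent generating system; a unimodular cone is a simplicial rational cone $C$ such that $\Delta_C$ is a unimodular simplex (multiplicity of a lattice simplex with vertices $v_0,\dots,v_e$: index of the subgroup $U$ generated by $v_i-v_0$ in the smallest direct summand of $\mathbb{Z}^d$ containing $U$; unimodular means multiplicity $1$). A unimodular cover of $C$ is a finite family of unimodular cones whose union is $C$. For $c\ge0$, $c\Delta_C$ is the dilate of $\Delta_C$ by $c$ with center $O$. $\mathfrak{c}_d^{\mathrm{cone}}$ is the infimum of natural numbers $c$ such that every rational $d$-dimensional cone $C\subset\mathbb{R}^d$ admits a unimodular cover $C=\bigcup_{j=1}^k C_j$ with $\mathrm{Hilb}(C_j)\subset c\Delta_C$ for all $j$. *)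

(* Defs.v *)
From HB Require Import structures.
From mathcomp Require Import all_boot all_order all_algebra.
From mathcomp Require Import reals.
Set Implicit Arguments. Unset Strict Implicit. Unset Printing Implicit Defensive.
Import Order.TTheory GRing.Theory Num.Theory.
Local Open Scope ring_scope.

Section Cones.
Variables (R : realType) (d : nat).
Notation vec := 'rV[R]_d.

Definition vset := vec -> Prop.

Definition integral (x : vec) : Prop := forall i, x 0 i \is a Num.int.

Definition rational_vec (x : vec) : Prop :=
  exists q : 'rV[rat]_d, x = map_mx (fun r : rat => ratr r) q.

Definition cone_gen (s : seq vec) : vset :=
  fun x => exists lam : 'I_(size s) -> R,
    (forall i, 0 <= lam i) /\ x = \sum_(i < size s) lam i *: s`_i.

Definition comb_in (P : R -> Prop) (S : vset) : vset :=
  fun x => exists s : seq vec, (forall v, v \in s -> S v) /\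
    exists lam : 'I_(size s) -> R, (forall i, P (lam i)) /\
      x = \sum_(i < size s) lam i *: s`_i.

Definition rational_cone (C : vset) : Prop :=
  exists s : seq vec, (forall v, v \in s -> rational_vec v) /\
    forall x, C x <-> cone_gen s x.

Definition pointed (C : vset) : Prop := forall x, C x -> C (- x) -> x = 0.

(* d-dimensional: the linear span C - C of C is all of R^d *)
Definition full_dim (C : vset) : Prop :=
  forall x : vec, exists y z, C y /\ C z /\ x = y - z.

Definition rat_cone (C : vset) : Prop := rational_cone C /\ pointed C.

Definition ray (v : vec) : vset := fun x => exists t : R, 0 <= t /\ x = t *: v.

Definition extreme_ray (C : vset) (v : vec) : Prop :=
  v != 0 /\ C v /\ forall x y, C x -> C y -> ray v (x + y) -> ray v x /\ ray v y.

Definition ext_int_gen (C : vset) : vset := fun v =>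
  extreme_ray C v /\ integral v /\
  forall x, ray v x -> integral x -> exists k : nat, x = k%:R *: v.

Definition conv (S : vset) : vset :=
  fun x => exists s : seq vec, (forall v, v \in s -> S v) /\
    exists lam : 'I_(size s) -> R, (forall i, 0 <= lam i) /\
      \sum_(i < size s) lam i = 1 /\ x = \sum_(i < size s) lam i *: s`_i.

Definition Delta (C : vset) : vset := conv (fun v => v = 0 \/ ext_int_gen C v).

Definition dilate (c : R) (S : vset) : vset := fun x => exists y, S y /\ x = c *: y.

Definition semigroup_gen (S : vset) : vset :=
  fun x => exists s : seq vec, (forall v, v \in s -> S v) /\ x = \sum_(v <- s) v.

Definition generates (C : vset) (H : vset) : Prop :=
  (forall v, H v -> C v /\ integral v) /\
  (forall x, C x -> integral x -> semigroup_gen H x).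

Definition finite_vset (H : vset) : Prop :=
  exists s : seq vec, forall v, H v <-> v \in s.

Definition hilbert_basis (C : vset) (H : vset) : Prop :=
  finite_vset H /\ generates C H /\
  forall H' : vset, (forall v, H' v -> H v) -> generates C H' -> forall v, H v -> H' v.

Definition simplicial (C : vset) : Prop :=
  exists s : seq vec, free s /\ forall x, C x <-> cone_gen s x.

(* unimodular: simplicial rational cone whose simplex Delta_C (vertices O and
   the extreme integral generators) has multiplicity 1, i.e. the group U
   generated by the extreme integral generators equals the smallest direct
   summand of Z^d containing it, (span_R U) ∩ Z^d *)
Definition unimodular (C : vset) : Prop :=
  rat_cone C /\ simplicial C /\
  forall x, integral x -> comb_in (fun _ => True) (ext_int_gen C) x ->
    comb_in (fun r => r \is a Num.int) (ext_int_gen C) x.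

Definition cone_cover_bound (c : nat) : Prop :=
  forall C : vset, rat_cone C -> full_dim C ->
    exists (k : nat) (Cs : 'I_k -> vset),
      (forall j, unimodular (Cs j)) /\
      (forall x, C x <-> exists j, Cs j x) /\
      (forall j (H : vset), hilbert_basis (Cs j) H ->
         forall v, H v -> dilate c%:R (Delta C) v).

End Cones.

Definition cone_bound (R : realType) (d : nat) : R :=
  let m : int := Num.ceil (Num.sqrt ((d.-1)%:R : R)) in
  m%:~R * (d.-1)%:R * ((d * d.+1)%:R / 2) * (3 / 2 : R) ^ (m * (d.-1)%:Z - 2)%R.

(* Main.v *)
Require Import Defs.
From HB Require Import structures.
From mathcomp Require Import all_boot all_order all_algebra.
From mathcomp Require Import reals.
From mathcomp Require Import perm boolp ring lra.
Set Implicit Arguments. Unset Strict Implicit. Unset Printing Implicit Defensive.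
Import Order.TTheory GRing.Theory Num.Theory.
Local Open Scope ring_scope.

(* A point x of C lies in a simplicial cone spanned by extreme integral
   generators v_0, ..., v_{d-1} (Caratheodory), ordered so that the coordinates
   of x decrease.  Only finitely many integral points lie in a dilate of
   Delta_C, so it suffices to find, for each x, a basis u of Z^d inside C whose
   v-coordinate sums are at most N and whose cone contains x: the resulting
   family of cones is automatically finite.

   Start with a basis g of Z^d adapted to the flag span(v_0, ..., v_j) and treat
   j = d-1, ..., 0 in turn, working modulo span(v_0, ..., v_{j-1}).  Write h for
   the j-th coordinate, z for the sum of the later ones and E = h - z/d.  Since
   x_j is the largest remaining coordinate, E(x) > 0 unless x_j = 0.
   Adding multiples of g_j to the vectors found so far makes their E-values lie
   in (-h(g_j), 0], and then x has a nonnegative coefficient on g_j as well.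
   While some basis vector n has h(n) < 0, there is a basis vector p with
   E(p) > 0; replace p or n by p + n, according to which of them has the smaller
   coefficient in x.  This keeps a basis whose cone contains x, and
   -1 < E, together with h <= 1 where E > 0, is preserved; so the vectors stay in
   a bounded region and the procedure stops.  The new vectors have
   h + z <= 2d + 1, which gives a bound N = (2d+1)d after all stages; for d = 2
   a sharper estimate gives N = 2. *)

(** * Bases of the integer lattice and adapted flags *)

Section LatticeBasis.
Variables (R : realType) (d : nat).
Implicit Types (u v : 'I_d -> 'rV[R]_d) (x y : 'rV[R]_d).

Lemma integralD x y : integral x -> integral y -> integral (x + y).
Proof. by move=> hx hy i; rewrite mxE rpredD. Qed.

Lemma integralZ (a : R) x : a \is a Num.int -> integral x -> integral (a *: x).
Proof. by move=> ha hx i; rewrite mxE rpredM. Qed.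

Lemma integralB x y : integral x -> integral y -> integral (x - y).
Proof. by move=> hx hy i; rewrite !mxE rpredB. Qed.

Lemma integral_delta (k : 'I_d) : integral (delta_mx 0 k : 'rV[R]_d).
Proof. by move=> i; rewrite mxE; case: (_ && _); rewrite ?rpred0 ?rpred1. Qed.

Definition lattice_basis u :=
  (forall i, integral (u i)) /\
  forall y, integral y ->
    exists a : 'I_d -> R, (forall i, a i \is a Num.int) /\ y = \sum_i a i *: u i.

Lemma lattice_basis_span u x : lattice_basis u ->
  exists a : 'I_d -> R, x = \sum_i a i *: u i.
Proof.
move=> [_ hu].
have /fin_all_exists [a ha] : forall k : 'I_d, exists a : 'I_d -> R,
    (delta_mx 0 k : 'rV[R]_d) = \sum_i a i *: u i.
  by move=> k; have [a [_ e]] := hu _ (integral_delta k); exists a.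
exists (fun i => \sum_k x 0 k * a k i).
rewrite [LHS]row_sum_delta; under eq_bigr do rewrite ha scaler_sumr.
rewrite exchange_big /=; apply: eq_bigr => i _.
by rewrite scaler_suml; apply: eq_bigr => k _; rewrite scalerA.
Qed.

Definition shear (p : 'I_d) (m : 'I_d -> R) u (i : 'I_d) := u i + m i *: u p.

Lemma shear_sum p m u (b : 'I_d -> R) : m p = 0 ->
  \sum_i b i *: u i =
  \sum_i (b i - (if i == p then \sum_l b l * m l else 0)) *: shear p m u i.
Proof.
move=> mp; under [RHS]eq_bigr do rewrite scalerBl.
rewrite sumrB (bigD1 p (F := fun i => (if i == p then _ else 0) *: _)) //= eqxx.
rewrite [X in _ - (_ + X)]big1 => [|i /negPf ->]; last by rewrite scale0r.
rewrite addr0 /shear mp scale0r addr0.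
under [X in _ = X - _]eq_bigr do rewrite scalerDr scalerA.
by rewrite big_split /= -scaler_suml addrK.
Qed.

Lemma lattice_basis_shear p m u : m p = 0 -> (forall i, m i \is a Num.int) ->
  lattice_basis u -> lattice_basis (shear p m u).
Proof.
move=> mp mi [ui us]; split=> [i|y /us [a [ai ->]]].
  by apply: integralD => //; apply: integralZ.
exists (fun i => a i - (if i == p then \sum_l a l * m l else 0)); split; last exact: shear_sum.
move=> i; rewrite rpredB //; case: eqP => _; last exact: rpred0.
by apply: rpred_sum => l _; rewrite rpredM.
Qed.

End LatticeBasis.

Lemma linear_sum_fun (R : realType) d n (f : 'rV[R]_d -> R) (c : 'I_n -> R) u :
  (forall a x y, f (a *: x + y) = a * f x + f y) ->
  f (\sum_i c i *: u i) = \sum_i c i * f (u i).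
Proof.
move=> fl; have f0 : f 0 = 0.
  by have := fl 1 0 0; rewrite scaler0 addr0 mul1r => /eqP; rewrite -subr_eq0 opprD addNKr oppr_eq0 => /eqP.
by elim/big_rec2: _ => // i a x _ IH; rewrite fl IH.
Qed.

Lemma int_gt0_ge1 (R : realType) (a : R) : a \is a Num.int -> 0 < a -> 1 <= a.
Proof. by move=> /intrP [m ->]; rewrite ltr0z -[1]/(1%:~R) ler_int gtz0_ge1. Qed.

Section Coordinates.
Variables (R : realType) (d : nat) (W : 'M[R]_d) (D : R).
Implicit Types (x y : 'rV[R]_d).

Definition co x (k : 'I_d) : R := (x *m W) 0 k.

Hypothesis W_unit : W \in unitmx.
Hypothesis D_gt0 : 0 < D.
Hypothesis D_int : forall x k, integral x -> D * co x k \is a Num.int.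
Variable v : 'I_d -> 'rV[R]_d.
Hypothesis v_int : forall k, integral (v k).
Hypothesis co_v : forall k l, co (v k) l = (k == l)%:R.

Lemma coP a x y k : co (a *: x + y) k = a * co x k + co y k.
Proof. by rewrite /co mulmxDl -scalemxAl !mxE. Qed.

Lemma coD x y k : co (x + y) k = co x k + co y k.
Proof. by have := coP 1 x y k; rewrite scale1r mul1r. Qed.

Lemma co0 k : co 0 k = 0.
Proof. by rewrite /co mul0mx mxE. Qed.

Lemma coZ a x k : co (a *: x) k = a * co x k.
Proof. by have := coP a x 0 k; rewrite !addr0 co0 addr0. Qed.

Lemma co_sum n (c : 'I_n -> R) (u : 'I_n -> 'rV[R]_d) k :
  co (\sum_i c i *: u i) k = \sum_i c i * co (u i) k.
Proof. by apply: (linear_sum_fun (f := fun x => co x k)) => a x y; exact: coP. Qed.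

Lemma co_eq0 x : (forall k, co x k = 0) -> x = 0.
Proof.
move=> h; rewrite -[x](mulmxK W_unit).
suff -> : x *m W = 0 by rewrite mul0mx.
by apply/rowP => k; rewrite [LHS]h mxE.
Qed.

(** By [co_v], this is membership in the span of [v 0], ..., [v (m-1)]. *)
Definition in_flag (m : nat) x := forall k : 'I_d, (m <= k)%N -> co x k = 0.

(** Positive values of the [i]-th coordinate on lattice vectors lie in [1/D] times the positive
    integers, so a least one exists; [v i] competes with the value 1. *)
Lemma flag_vector (i : 'I_d) : exists g : 'rV[R]_d,
  [/\ integral g, in_flag i.+1 g, 0 < co g i, co g i <= 1 &
   forall y, integral y -> in_flag i.+1 y -> 0 < co y i -> co g i <= co y i].
Proof.
pose P n := `[< exists y, [/\ integral y, in_flag i.+1 y, 0 < co y i & D * co y i = n%:R] >].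
have toP y : integral y -> in_flag i.+1 y -> 0 < co y i ->
    exists2 n, P n & D * co y i = n%:R.
  move=> yi yf y0.
  have : D * co y i \is a Num.nat by rewrite natrEint D_int // mulr_ge0 // ltW.
  by case/natrP => n e; exists n => //; apply/asboolP; exists y.
have vf : in_flag i.+1 (v i) by move=> k ik; rewrite co_v; case: eqP ik => // ->; rewrite ltnn.
have v1 : co (v i) i = 1 by rewrite co_v eqxx.
have [n0 Pn0 en0] : exists2 n, P n & D * co (v i) i = n%:R by apply: toP => //; rewrite v1.
have exP : exists n, P n by exists n0.
case: (ex_minnP exP) => n /asboolP [g [gi gf g0 eg]] nmin.
have gmin y : integral y -> in_flag i.+1 y -> 0 < co y i -> co g i <= co y i.
  move=> yi yf y0; have [m Pm em] := toP y yi yf y0.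
  by rewrite -(ler_pM2l D_gt0) eg em ler_nat nmin.
by exists g; split=> //; rewrite -v1 gmin // v1.
Qed.

Definition flag_basis (g : 'I_d -> 'rV[R]_d) := forall i : 'I_d,
  [/\ integral (g i), in_flag i.+1 (g i), 0 < co (g i) i, co (g i) i <= 1 &
   forall y, integral y -> in_flag i.+1 y -> 0 < co y i -> co (g i) i <= co y i].

Lemma flag_basis_exists : exists g, flag_basis g.
Proof. exact: fin_all_exists flag_vector. Qed.

(** Descend the flag, clearing the top coordinate with a multiple [q] of the corresponding [g i]. *)
Lemma flag_basis_decomp g m x : flag_basis g -> in_flag m x ->
  exists a : 'I_d -> R, [/\ forall i : 'I_d, (m <= i)%N -> a i = 0,
    x = \sum_i a i *: g i & integral x -> forall i, a i \is a Num.int].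
Proof.
move=> gP; elim: m x => [|m IH] x xm.
  exists (fun=> 0); split=> [//||_ i]; last by rewrite rpred0.
  rewrite big1 => [|i _]; last by rewrite scale0r.
  by apply: co_eq0 => k; apply: xm.
case: (ltnP m d) => [md|dm]; last first.
  have [|a [a0 ax ai]] := IH x.
    by move=> k mk; move: (ltn_ord k); rewrite ltnNge (leq_trans dm mk).
  by exists a; split=> // i mi; apply: a0; apply: ltnW.
pose i := Ordinal md; have [gi gf g0 g1 gmin] := gP i.
pose q := co x i / co (g i) i.
have xq : in_flag m (x - q *: g i).
  move=> k; rewrite leq_eqVlt => /orP [/eqP mk|mk]; last first.
    by rewrite -scaleNr addrC coP xm // (gf k) // mulr0 addr0.
  have -> : k = i by apply: val_inj.
  by rewrite -scaleNr addrC coP mulNr divfK ?gt_eqF // addNr.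
have [a [a0 ax ai]] := IH _ xq.
exists (fun k => a k + (k == i)%:R * q); split=> [k mk||xi k].
- rewrite a0 1?ltnW // add0r; case: eqP => [e|_]; last by rewrite mul0r.
  by move: mk; rewrite e /= ltnn.
- under eq_bigr do rewrite scalerDl -scalerA.
  rewrite big_split /= -ax (bigD1 i (P := xpredT)) //= eqxx scale1r big1 => [|k /negPf ->].
    by rewrite addr0 subrK.
  by rewrite scale0r.
suff qi : q \is a Num.int.
  rewrite rpredD //; first by apply: ai; apply: integralB => //; apply: integralZ.
  by rewrite rpredM //; case: (_ == _); rewrite ?rpred0 ?rpred1.
(* If [q] were not an integer, subtracting only [f] copies of [g i] would leave a lattice vector
   whose [i]-th coordinate is positive and below the minimum. *)
pose f : R := (Num.floor q)%:~R.
have fi : f \is a Num.int by apply: intr_int.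
have [fq qf] : f <= q /\ q < f + 1 by rewrite /f -[1]/(1%:~R) -intrD; split; [exact: floor_le|exact: floorD1_gt].
have cy : co (x - f *: g i) i = (q - f) * co (g i) i.
  by rewrite -scaleNr addrC coP mulNr mulrBl /q divfK ?gt_eqF // addrC.
suff -> : q = f by [].
apply/eqP; rewrite eq_le fq andbT leNgt; apply/negP => fltq.
have := gmin (x - f *: g i); rewrite cy pmulr_lgt0 // subr_gt0 fltq.
rewrite -subr_ge0 -{2}[co (g i) i]mul1r -mulrBl pmulr_lge0 //.
have -> : 0 <= q - f - 1 = false by apply/negbTE; rewrite -ltNge; lra.
suff [yi yf] : integral (x - f *: g i) /\ in_flag m.+1 (x - f *: g i) by move/(_ yi yf isT).
split; first by apply: integralB => //; apply: integralZ.
by move=> l ml; rewrite -scaleNr addrC coP (xm l) // (gf l) // mulr0 addr0.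
Qed.

Lemma flag_basis_lattice g : flag_basis g -> lattice_basis g.
Proof.
move=> gP; split=> [i|y yi]; first by case: (gP i).
have [|a [_ ya ai]] := @flag_basis_decomp g d y gP; last by exists a; split=> //; exact: ai.
by move=> k; rewrite leqNgt ltn_ord.
Qed.

End Coordinates.

(** * The descent at one stage *)

Section Descent.
Variables (R : realType) (d : nat) (W : 'M[R]_d) (D : R).
Implicit Types (x y : 'rV[R]_d) (u : 'I_d -> 'rV[R]_d).
Hypothesis D_gt0 : 0 < D.
Hypothesis D_int : forall x k, integral x -> D * co W x k \is a Num.int.
Variable j : 'I_d.

Definition tail x : R := \sum_(k < d | (j < k)%N) co W x k.
Definition excess x : R := co W x j - tail x / d%:R.

Lemma tailP a x y : tail (a *: x + y) = a * tail x + tail y.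
Proof. by rewrite /tail mulr_sumr -big_split; apply: eq_bigr => k _; rewrite coP. Qed.

Lemma excessP a x y : excess (a *: x + y) = a * excess x + excess y.
Proof. by rewrite /excess coP tailP; ring. Qed.

Lemma tailD x y : tail (x + y) = tail x + tail y.
Proof. by have := tailP 1 x y; rewrite scale1r mul1r. Qed.

Lemma excessD x y : excess (x + y) = excess x + excess y.
Proof. by have := excessP 1 x y; rewrite scale1r mul1r. Qed.

Lemma tail_ge0 x : (forall k : 'I_d, (j < k)%N -> 0 <= co W x k) -> 0 <= tail x.
Proof. by move=> h; apply: sumr_ge0. Qed.

Lemma tail_excess x : tail x = d%:R * (co W x j - excess x).
Proof.
rewrite /excess opprB addrC subrK mulrC divfK // pnatr_eq0.
by case: (d) j => // -[].
Qed.

Variables h0 K : R.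
Hypothesis h0_le1 : h0 <= 1.
Hypothesis h0_min : forall y, integral y -> in_flag W j.+1 y -> co W y j < 0 ->
  co W y j <= - h0.

(* [K] bounds the coordinate sum only of the vectors that need no further change. *)
Definition good_vector y :=
  [/\ forall k : 'I_d, (j < k)%N -> 0 <= co W y k, - h0 < excess y,
   0 < excess y -> co W y j <= 1 & 0 <= co W y j -> co W y j + tail y <= K].

Definition good_basis u :=
  lattice_basis u /\ forall i : 'I_d, (j <= i)%N -> good_vector (u i).

Hypothesis K_step : forall u (p n : 'I_d), good_basis u -> (j <= p)%N -> (j <= n)%N ->
  0 < excess (u p) -> co W (u n) j < 0 -> 0 <= co W (u p + u n) j ->
  co W (u p + u n) j + tail (u p + u n) <= K.

(* On lattice vectors the gauge increases by at least 1 at each step of the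
   descent; its boundedness on good vectors yields termination. *)
Definition gauge y : R := D * co W y j + (D + 1) * (D * tail y).

Lemma gaugeD x y : gauge (x + y) = gauge x + gauge y.
Proof. by rewrite /gauge coD tailD; ring. Qed.

Lemma tail_int y : integral y -> D * tail y \is a Num.int.
Proof. by move=> yi; rewrite mulr_sumr rpred_sum // => k _; apply: D_int. Qed.

Lemma excess_gt0_co y : good_vector y -> 0 < excess y -> 0 < co W y j.
Proof.
move=> [y0 _ _ _]; rewrite /excess subr_gt0 => /le_lt_trans; apply.
by rewrite divr_ge0 ?tail_ge0.
Qed.

Lemma gauge_ge1_pos y : integral y -> good_vector y -> 0 < excess y -> 1 <= gauge y.
Proof.
move=> yi yg Ey; have y0 := excess_gt0_co yg Ey; case: yg => yt _ _ _.
rewrite -[1]addr0 lerD ?int_gt0_ge1 ?D_int ?mulr_gt0 //.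
by rewrite !mulr_ge0 ?tail_ge0 ?addr_ge0 // ltW.
Qed.

(** A zero tail would put [y] in the flag, where [h0_min] contradicts the lower bound on the excess.
    Hence [D * tail y] is at least 1, and the weight [D + 1] outweighs [D * co W y j > - D]. *)
Lemma gauge_ge1_neg y : integral y -> good_vector y -> co W y j < 0 -> 1 <= gauge y.
Proof.
move=> yi [yt Ey _ _] hy; have t0 := tail_ge0 yt.
have [te|tn0] := eqVneq (tail y) 0.
  have /h0_min : in_flag W j.+1 y.
    move=> k jk; apply: le_anti; rewrite yt // andbT -te /tail.
    by rewrite (bigD1 k) //= lerDl sumr_ge0 // => l /andP[jl _]; apply: yt.
  by move=> /(_ yi hy); move: Ey; rewrite /excess te mul0r subr0 => /lt_le_trans h /h; rewrite ltxx.
have t1 : 1 <= D * tail y by rewrite int_gt0_ge1 ?tail_int ?mulr_gt0 // lt_def tn0.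
have hh : - 1 < co W y j.
  have : 0 <= tail y / d%:R by rewrite divr_ge0.
    by move: Ey; rewrite /excess; move: (tail y / d%:R) h0_le1 => e; lra.
have : - D <= D * co W y j by rewrite -mulrN1 ler_pM2l // ltW.
have : D + 1 <= (D + 1) * (D * tail y) by rewrite ler_peMr // addr_ge0 // ltW.
by rewrite /gauge; lra.
Qed.

Definition gauge_bound : R := D * `|K| + (D + 1) * (D * (`|K| + d%:R)).

(** If the [j]-th coordinate is nonnegative, [K] bounds it and the tail; if it is negative,
    [tail_excess] and [excess y > - h0 >= -1] bound the tail by [d]. *)
Lemma gauge_le y : good_vector y -> gauge y <= gauge_bound.
Proof.
move=> [yt Ey _ Ky]; have t0 := tail_ge0 yt.
have [hK tK] : co W y j <= `|K| /\ tail y <= `|K| + d%:R.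
  have KK := ler_norm K; have K0 := normr_ge0 K.
  have d0 : 0 <= d%:R :> R by [].
  case: (ltP (co W y j) 0) => [h|h]; last first.
    have := Ky h => hK; split; first by lra.
    by rewrite -[tail y]addr0 lerD //; lra.
  split; first lra.
  apply: (@le_trans _ _ d%:R); last by rewrite lerDr.
  by rewrite tail_excess -{2}[d%:R]mulr1 ler_wpM2l //; move: (excess y) h Ey h0_le1 => e; lra.
by apply: lerD; rewrite !ler_pM2l ?addr_gt0.
Qed.

Definition deficit u : R := \sum_(i < d | (j <= i)%N) (gauge_bound - gauge (u i)).

Lemma deficit_ge0 u : good_basis u -> 0 <= deficit u.
Proof. by move=> [_ ug]; apply: sumr_ge0 => i ji; rewrite subr_ge0; apply: gauge_le; apply: ug. Qed.

(** Coefficients below index [j] are free, since the stage works modulo the earlier vectors. *)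
Definition represents x u (c : 'I_d -> R) :=
  x = \sum_i c i *: u i /\ forall i : 'I_d, (j <= i)%N -> 0 <= c i.

(** Rewrite [c p * u p + c q * u q] as [(c p - c q) * u p + c q * (u q + u p)]; the deficit drops by
    the gauge of [u p]. *)
Lemma descent_step x u c (p q : 'I_d) : good_basis u -> represents x u c -> p != q ->
  (j <= p)%N -> (j <= q)%N -> 1 <= gauge (u p) -> good_vector (u q + u p) -> c q <= c p ->
  exists u' c', [/\ good_basis u', represents x u' c',
    forall i : 'I_d, (i < j)%N -> u' i = u i & deficit u' <= deficit u - 1].
Proof.
move=> [ub ug] [xu c0] pq jp jq gp gs cqp.
pose m i : R := (i == q)%:R.
have mp : m p = 0 by rewrite /m (negPf pq).
have uE i : shear p m u i = if i == q then u q + u p else u i.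
  by rewrite /shear /m; case: eqP => [->|_]; rewrite ?scale1r // scale0r addr0.
exists (shear p m u), (fun i => c i - (if i == p then \sum_l c l * m l else 0)); split.
- split; first by apply: lattice_basis_shear => // i; rewrite /m; case: eqP; rewrite ?rpred0 ?rpred1.
  by move=> i ji; rewrite uE; case: eqP => // _; apply: ug.
- split; first by rewrite xu; apply: shear_sum.
  move=> i ji; case: eqP => [->|_]; last by rewrite subr0 c0.
  rewrite (bigD1 q) //= /m eqxx mulr1 big1 ?addr0 ?subr_ge0 // => l /negPf ->.
  by rewrite mulr0.
- by move=> i ij; rewrite uE; case: eqP => // e; move: ij; rewrite e ltnNge jq.
rewrite /deficit (bigD1 q) //= [X in _ <= X - 1](bigD1 q) //= uE eqxx gaugeD.
rewrite (eq_bigr (fun i => gauge_bound - gauge (u i))); first lra.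
by move=> i /andP[_ /negPf iq]; rewrite uE iq.
Qed.

(** Induction on a natural number above the deficit, which is nonnegative and drops by at least 1
    per step. *)
Lemma descent x u c : good_basis u -> represents x u c -> 0 < excess x ->
  (forall i : 'I_d, (i < j)%N -> excess (u i) = 0) ->
  exists u' c', [/\ good_basis u', represents x u' c',
    forall i : 'I_d, (i < j)%N -> u' i = u i &
    forall i : 'I_d, (j <= i)%N -> 0 <= co W (u' i) j].
Proof.
move=> ug xu Ex u0.
have [n] : exists n : nat, deficit u < n%:R.
  by exists (Num.truncn (deficit u)).+1; rewrite truncnS_gt.
elim: n u c ug xu u0 => [|n IH] u c ug xu u0 un.
  by have := deficit_ge0 ug; rewrite leNgt un.
have [hn|hn] := pselect (exists n : 'I_d, (j <= n)%N /\ co W (u n) j < 0); last first.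
  exists u, c; split=> // i ji; rewrite leNgt; apply/negP => hi; apply: hn; by exists i.
have [m [jm hm]] := hn.
(* Otherwise every term of the excess of [x] would be nonpositive. *)
have [p [jp Ep]] : exists p : 'I_d, (j <= p)%N /\ 0 < excess (u p).
  apply: contrapT => np; move: Ex; case: xu => -> c0.
  rewrite (linear_sum_fun _ _ excessP) ltNge => /negP; apply.
  apply: sumr_le0 => i _; case: (ltnP i j) => [/u0 ->|ji]; first by rewrite mulr0.
  rewrite mulr_ge0_le0 ?c0 // leNgt; apply/negP => Ei; apply: np; by exists i.
have [ub ugv] := ug; have [ui _] := ub.
have pm : p != m.
  apply/eqP => e; have := excess_gt0_co (ugv _ jp) Ep.
  by rewrite e ltNge ltW.
(* The excess can only grow from that of [u m], and the [j]-th coordinate can only drop from that of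
   [u p]. *)
have gs : good_vector (u p + u m).
  have [pt pE ph _] := ugv _ jp; have [mt mE _ _] := ugv _ jm.
  split; [| | |exact: K_step].
  - by move=> k jk; rewrite coD addr_ge0 ?pt ?mt.
  - by rewrite excessD; lra.
  by rewrite coD => _; have := ph Ep; lra.
have [u' [c' [ug' xu' uu' du']]] : exists u' c', [/\ good_basis u', represents x u' c',
    forall i : 'I_d, (i < j)%N -> u' i = u i & deficit u' <= deficit u - 1].
  (* The vector with the smaller coefficient is replaced by the sum; the other one, whose gauge is
     at least 1, is kept. *)
  case: (leP (c m) (c p)) => [cc|/ltW cc].
    apply: (@descent_step x u c p m) => //; last by rewrite addrC.
    by apply: gauge_ge1_pos => //; apply: ugv.
  apply: (@descent_step x u c m p); rewrite // 1?eq_sym //.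
  by apply: gauge_ge1_neg => //; apply: ugv.
have [||u'' [c'' [ug'' xu'' uu'' pos'']]] := IH u' c' ug' xu'.
- by move=> i ij; rewrite uu' // u0.
- by move: un; rewrite -natr1; lra.
exists u'', c''; split=> // i ij; by rewrite uu'' // uu'.
Qed.

End Descent.

(** * Running through the flag *)

Section Stage.
Variables (R : realType) (d : nat) (W : 'M[R]_d) (D : R).
Implicit Types (x y : 'rV[R]_d) (u : 'I_d -> 'rV[R]_d).
Hypothesis W_unit : W \in unitmx.
Hypothesis D_gt0 : 0 < D.
Hypothesis D_int : forall x k, integral x -> D * co W x k \is a Num.int.
Variable v : 'I_d -> 'rV[R]_d.
Hypothesis v_int : forall k, integral (v k).
Hypothesis co_v : forall k l, co W (v k) l = (k == l)%:R.
Variable g : 'I_d -> 'rV[R]_d.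
Hypothesis gP : flag_basis W g.

Definition decreasing_nonneg x := (forall k, 0 <= co W x k) /\
  forall k l : 'I_d, (k <= l)%N -> co W x l <= co W x k.

(** The state between stages: at [m = d] the basis is [g] itself, and at [m = 0] it lies in the cone
    of the [v k] and its own cone contains [x]. *)
Definition covered_mod_flag (m : nat) (b : R) x := exists u c,
  [/\ lattice_basis u, forall i : 'I_d, (i < m)%N -> u i = g i,
   forall i : 'I_d, (m <= i)%N ->
     (forall k : 'I_d, (m <= k)%N -> 0 <= co W (u i) k) /\
     \sum_(k < d | (m <= k)%N) co W (u i) k <= b &
   x = \sum_i c i *: u i /\ forall i : 'I_d, (m <= i)%N -> 0 <= c i].

(** The hypothesis [K_step] of the descent with [h0 = co W (g j) j], kept abstract because the
    planar and the general case prove it differently. *)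
Definition sum_bound (j : 'I_d) (K : R) := forall u (p n : 'I_d),
  good_basis W j (co W (g j) j) K u -> (j <= p)%N -> (j <= n)%N ->
  0 < excess W j (u p) -> co W (u n) j < 0 -> 0 <= co W (u p + u n) j ->
  co W (u p + u n) j + tail W j (u p + u n) <= K.

Lemma tail_flag (j : 'I_d) x : in_flag W j.+1 x -> tail W j x = 0.
Proof. by move=> xf; apply: big1 => k jk; apply: xf. Qed.

Lemma sum_from (j : 'I_d) x :
  \sum_(k < d | (j <= k)%N) co W x k = co W x j + tail W j x.
Proof.
rewrite (bigD1 j) //=; congr (_ + _); apply: eq_bigl => k.
by rewrite ltn_neqAle andbC eq_sym.
Qed.

(** Each coordinate from [j] on is at most the [j]-th, so together they sum to at most [d] times it;
    the tail alone is strictly less. *)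
Lemma excess_gt0 (j : 'I_d) x : decreasing_nonneg x -> 0 < co W x j -> 0 < excess W j x.
Proof.
move=> [x0 xd] xj; have d0 : 0 < d%:R :> R by rewrite ltr0n (leq_ltn_trans _ (ltn_ord j)).
rewrite /excess subr_gt0 ltr_pdivrMr // -(ltrD2l (co W x j)) -sum_from.
apply: (@le_lt_trans _ _ (co W x j * d%:R)); last by rewrite ltrDr.
have -> : co W x j * d%:R = \sum_(k < d) co W x j by rewrite sumr_const card_ord mulr_natr.
by rewrite big_mkcond; apply: ler_sum => k _; case: ifP => // /xd.
Qed.

Lemma stage_pos (j : 'I_d) (b K : R) x : sum_bound j K -> 1 <= K ->
  b + b / d%:R <= K -> decreasing_nonneg x -> 0 < co W x j ->
  covered_mod_flag j.+1 b x -> covered_mod_flag j K x.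
Proof.
move=> jK K1 bK xd xj [u [c [ub ug us [xu c0]]]].
have [gi gf h0 h1 gmin] := gP j; set h := co W (g j) j in h0 h1 gmin.
have Ex := excess_gt0 xd xj.
have Eg : excess W j (g j) = h by rewrite /excess tail_flag // mul0r subr0.
have d0 : 0 < d%:R :> R by rewrite ltr0n (leq_ltn_trans _ (ltn_ord j)).
(* Since [g j] has excess [h], this integer multiple of it moves the excess of [u i] into the
   interval from [-h] (excluded) to 0 (included). *)
pose m (i : 'I_d) : R := if (j < i)%N then (Num.floor (- excess W j (u i) / h))%:~R else 0.
have mj : m j = 0 by rewrite /m ltnn.
have mi i : m i \is a Num.int by rewrite /m; case: ifP; rewrite ?intr_int ?rpred0.
pose w := shear j m u; pose a i := c i - (if i == j then \sum_l c l * m l else 0).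
have uj : u j = g j by apply: ug.
have wE i : w i = m i *: g j + u i by rewrite /w /shear uj addrC.
have wj : w j = g j by rewrite wE mj scale0r add0r.
have wl (i : 'I_d) : (i < j)%N -> w i = g i.
  by move=> ij; rewrite wE /m ltnNge (ltnW ij) scale0r add0r ug // ltnW.
have Ew (i : 'I_d) : (j < i)%N -> - h < excess W j (w i) <= 0.
  move=> ji; rewrite wE excessP Eg /m ji.
  set q := - excess W j (u i) / h.
  have -> : excess W j (u i) = - q * h by rewrite mulNr divfK ?gt_eqF // opprK.
  have := floor_le q; have := floorD1_gt q; rewrite intrD => q1 q2.
  rewrite -mulrDl -{1}[h]mul1r -mulNr ltr_pM2r // pmulr_lle0 //; lra.
have Ewl (i : 'I_d) : (i < j)%N -> excess W j (w i) = 0.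
  move=> ij; have [_ gif _ _ _] := gP i; rewrite wl // /excess tail_flag ?mul0r ?subr0 ?gif //.
  by move=> k jk; apply: gif; apply: leq_trans (ltnW jk).
have wb : lattice_basis w by apply: lattice_basis_shear.
have xw : x = \sum_i a i *: w i by rewrite xu; apply: shear_sum.
(* A negative coefficient on [g j] would make the excess of [x] nonpositive, as the other vectors
   from [j] on have excess at most 0 and the earlier ones excess 0. *)
have a0 : forall i : 'I_d, (j <= i)%N -> 0 <= a i.
  have a1 (i : 'I_d) : (j < i)%N -> 0 <= a i.
    by move=> ji; rewrite /a; case: eqP ji => [->|_ ji]; rewrite ?ltnn // subr0 c0.
  move=> i; rewrite leq_eqVlt => /orP [/eqP ji|]; last exact: a1.
  have -> : i = j by apply: val_inj.
  rewrite leNgt; apply/negP => aj; move: Ex.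
  rewrite {1}xw (linear_sum_fun _ _ (@excessP _ _ W j)) ltNge => /negP; apply.
  apply: sumr_le0 => l _; case: (ltngtP l j) => [/Ewl ->|jl|/val_inj ->].
  - by rewrite mulr0.
  - by rewrite mulr_ge0_le0 ?a1 //; case/andP: (Ew _ jl).
  by rewrite wj Eg mulr_le0_ge0 // ltW.
have wg : good_basis W j h K w.
  split=> // i; rewrite leq_eqVlt => /orP [/eqP /val_inj <-|ji].
    rewrite wj; split=> [k jk||//|_]; first by rewrite gf.
      by rewrite Eg; lra.
    by rewrite tail_flag // addr0; apply: le_trans h1 K1.
  have [ui ub'] := us i ji; case/andP: (Ew i ji) => E1 E2.
  have tw : tail W j (w i) = tail W j (u i) by rewrite wE tailP tail_flag // mulr0 add0r.
  split=> // [k jk||_].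
  - by rewrite wE coP gf // mulr0 add0r ui.
  - by rewrite ltNge E2.
  (* Nonpositive excess bounds the [j]-th coordinate by [b / d], whence the condition
     [b + b / d <= K]. *)
  have tb : tail W j (w i) <= b by rewrite tw.
  have tdb : tail W j (w i) / d%:R <= b / d%:R by rewrite ler_pM2r ?invr_gt0.
  move: E2 tb tdb bK; rewrite /excess.
  by move: (tail W j (w i) / d%:R) (b / d%:R) => e1 e2; lra.
have h_min y : integral y -> in_flag W j.+1 y -> co W y j < 0 -> co W y j <= - h.
  move=> yi yf yj; rewrite lerNr -mulN1r -coZ; apply: gmin.
  - by apply: integralZ => //; rewrite rpredN rpred1.
  - by move=> k jk; rewrite coZ yf // mulr0.
  by rewrite coZ mulN1r oppr_gt0.
have [u' [c' [[ub' ug'] [xu' c0'] uu' u0']]] :=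
  descent D_gt0 D_int h1 h_min jK wg (conj xw a0) Ex Ewl.
exists u', c'; split=> //; first by move=> i ij; rewrite uu' // wl.
move=> i ji; have [t0 _ _ tK] := ug' i ji; split; last by rewrite sum_from tK ?u0'.
by move=> k; rewrite leq_eqVlt => /orP [/eqP /val_inj <-|]; [exact: u0'|exact: t0].
Qed.

Lemma stage (j : 'I_d) (b K : R) : sum_bound j K -> 1 <= K -> b + b / d%:R <= K ->
  (forall x, decreasing_nonneg x -> covered_mod_flag j.+1 b x) ->
  forall x, decreasing_nonneg x -> covered_mod_flag j K x.
Proof.
move=> jK K1 bK IH x xd.
have [xj|xj] := ltP 0 (co W x j); first by apply: (stage_pos jK K1 bK) => //; apply: IH.
(* The excess of [x] vanishes, so use the basis found for the all-ones vector. *)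
have xf : in_flag W j x.
  by move=> k jk; case: xd => x0 xd; apply: le_anti; rewrite x0 (le_trans (xd _ _ jk)).
pose y := \sum_k 1 *: v k.
have coy k : co W y k = 1.
  rewrite co_sum (bigD1 k) //= co_v eqxx mulr1 big1 ?addr0 // => l /negPf lk.
  by rewrite co_v lk mulr0.
have yd : decreasing_nonneg y by split=> *; rewrite !coy.
have [u [c [ub ug us _]]] : covered_mod_flag j K y.
  by apply: (stage_pos jK K1 bK) => //; [rewrite coy|apply: IH].
(* Now [x] is a combination of [g i] with [i < j], which belong to the basis found for [y]; its
   other coefficients are 0. *)
have [a [a0 xa _]] := flag_basis_decomp W_unit gP xf.
exists u, a; split=> //; split; last by move=> i ji; rewrite a0.
rewrite xa; apply: eq_bigr => i _; case: (ltnP i j) => [/ug -> //|/a0 ->].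
by rewrite !scale0r.
Qed.

Lemma covered_full x : covered_mod_flag d 0 x.
Proof.
have gb := flag_basis_lattice W_unit gP; have [a xa] := lattice_basis_span x gb.
by exists g, a; split=> // [i|]; [|split=> // i]; rewrite leqNgt ltn_ord.
Qed.

Lemma all_stages (b : nat -> R) : b d = 0 ->
  (forall j : 'I_d, [/\ sum_bound j (b j), 1 <= b j & b j.+1 + b j.+1 / d%:R <= b j]) ->
  forall x, decreasing_nonneg x -> covered_mod_flag 0 (b 0%N) x.
Proof.
move=> bd bP; suff H n : (n <= d)%N -> forall x, decreasing_nonneg x -> covered_mod_flag (d - n) (b (d - n)%N) x.
  by move=> x; rewrite -(subnn d); apply: H.
elim: n => [_ x _|n IH nd]; first by rewrite subn0 bd; apply: covered_full.
have jd : (d - n.+1 < d)%N by rewrite ltn_subrL (leq_trans _ nd).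
have [b1 b2 b3] := bP (Ordinal jd).
by apply: (stage b1 b2 b3); rewrite /= subnSK //; apply: IH; apply: ltnW.
Qed.

(** The sum has [j]-th coordinate at most 1 and excess above -1, so its tail is at most [2 d] by
    [tail_excess]. *)
Lemma sum_bound_general (j : 'I_d) (K : R) : 2 * d%:R + 1 <= K -> sum_bound j K.
Proof.
move=> dK u p n [_ ug] jp jn Ep hn _; apply: le_trans dK.
have [_ _ p1 _] := ug p jp; have [_ En _ _] := ug n jn.
have [_ _ _ h1 _] := gP j; have hp := p1 Ep.
have d0 : 0 <= d%:R :> R by [].
rewrite tail_excess coD excessD addrC lerD //; last by lra.
rewrite mulrC ler_wpM2r //; lra.
Qed.

End Stage.

(** The first equation gives [a] and [b] the same sign, and the second excludes that both are
    nonpositive. *)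
Lemma both_coefs_gt0 (R : realType) (a b p n s t : R) : 0 < p -> n < 0 -> 0 <= s -> 0 <= t ->
  a * p + b * n = 0 -> a * s + b * t = 1 -> 0 < a /\ 0 < b.
Proof.
move=> p0 n0 s0 t0 e0 e1.
have ab : 0 < a -> 0 < b.
  move=> a0; have : 0 < b * n * n by rewrite -(addr0_eq e0) mulNr oppr_gt0 nmulr_llt0 // mulr_gt0.
  by rewrite -mulrA pmulr_lgt0 // nmulr_rgt0.
suff a0 : 0 < a by split=> //; apply: ab.
rewrite ltNge; apply/negP => a0.
have b0 : b <= 0.
  by rewrite -(nmulr_lge0 _ n0) -(addr0_eq e0) oppr_ge0 mulr_le0_ge0 // ltW.
have := mulr_le0_ge0 a0 s0; have := mulr_le0_ge0 b0 t0; lra.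
Qed.

(* [v 1 = a p + b n] with positive integers [a], [b], so the second coordinates of
   [p] and [n] add up to at most 1. *)
Lemma sum_bound_plane (R : realType) (d : nat) (W : 'M[R]_d) (v g : 'I_d -> 'rV[R]_d)
    (j : 'I_d) : d = 2%N ->
  (forall k, integral (v k)) -> (forall k l, co W (v k) l = (k == l)%:R) ->
  sum_bound W g j (2 - j%:R).
Proof.
move=> d2; subst d => v_int co_v u p n [[_ us] ug] jp jn Ep hn _.
have gp := ug p jp; have hp := excess_gt0_co gp Ep.
have [pt _ p1 _] := gp; have [nt _ _ _] := ug n jn.
have pn : p != n by apply/eqP => e; move: hp; rewrite e ltNge ltW.
(* Two distinct indices at least [j] exist among 0 and 1. *)
have j0 : j = 0.
  apply: val_inj; move: jp jn pn; rewrite -val_eqE /=.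
  by move: (ltn_ord j) (ltn_ord p) (ltn_ord n); case: (val j) (val p) (val n) => [|[|[]]] // [|[|[]]] // [|[|[]]].
have tE x : tail W j x = co W x 1.
  rewrite /tail (bigD1 1) //= ?j0 // big1 ?addr0 // => k /andP [].
  by rewrite -val_eqE /=; move: (ltn_ord k); case: (val k) => [|[|[]]].
have [a [ai va]] := us _ (v_int 1).
have two (f : 'I_2 -> R) : \sum_i f i = f p + f n.
  rewrite (bigD1 p) //= (bigD1 n) 1?eq_sym //= big1 ?addr0 // => k.
  move: pn; rewrite -!val_eqE /=.
  by move: (ltn_ord k) (ltn_ord p) (ltn_ord n); case: (val k) (val p) (val n) => [|[|[]]] // [|[|[]]] // [|[|[]]].
have e0 : a p * co W (u p) 0 + a n * co W (u n) 0 = 0.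
  by rewrite -(two (fun i => a i * _)) -co_sum -va co_v.
have e1 : a p * co W (u p) 1 + a n * co W (u n) 1 = 1.
  by rewrite -(two (fun i => a i * _)) -co_sum -va co_v.
have p0 : 0 <= co W (u p) 1 by apply: pt; rewrite j0.
have n0 : 0 <= co W (u n) 1 by apply: nt; rewrite j0.
rewrite j0 in hp hn p1 Ep *.
have [ap an] := both_coefs_gt0 hp hn p0 n0 e0 e1.
have ap1 := int_gt0_ge1 (ai p) ap; have an1 := int_gt0_ge1 (ai n) an.
have pn1 : co W (u p) 1 + co W (u n) 1 <= 1.
  by rewrite -e1 lerD // ler_peMl.
rewrite -[in tail _ _]j0 tE !coD subr0; have := p1 Ep; lra.
Qed.

(** For [d = 2] the required bound equals 2, so the general value 10 would not do. *)
Definition cover_size (d : nat) : nat := if d == 2%N then 2%N else ((2 * d + 1) * d)%N.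

(** * Lattice bases inside a simplicial cone *)

Section Simplicial.
Variables (R : realType) (d : nat) (V : 'M[R]_d).
Hypothesis V_unit : V \in unitmx.
Hypothesis V_int : forall k, integral (row k V).

(** Cramer's rule: the inverse is the adjugate, an integral matrix, divided by the determinant. *)
Lemma invmx_denominator (x : 'rV[R]_d) k : integral x ->
  `|\det V| * co (invmx V) x k \is a Num.int.
Proof.
move=> xi; rewrite /co /invmx V_unit -scalemxAr mxE mulrA rpredM //.
  case: (ger0P (\det V)) => _; rewrite ?mulNr divff ?rpredN ?rpred1 //;
  by move: V_unit; rewrite unitmxE unitfE.
have -> : V = map_mx intr (map_mx Num.floor V).
  by apply/matrixP => i l; rewrite !mxE floorK //; have := V_int i l; rewrite mxE.
rewrite -map_mx_adj mxE rpred_sum // => l _; rewrite rpredM ?xi //.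
by rewrite mxE intr_int.
Qed.

Lemma simplicial_cover (a : 'I_d -> R) : (2 <= d)%N ->
  (forall k, 0 <= a k) -> (forall k l : 'I_d, (k <= l)%N -> a l <= a k) ->
  exists u c, [/\ lattice_basis u, forall i, 0 <= c i,
    \sum_k a k *: row k V = \sum_i c i *: u i &
    forall i, exists e : 'I_d -> R, [/\ forall k, 0 <= e k,
      \sum_k e k <= (cover_size d)%:R & u i = \sum_k e k *: row k V]].
Proof.
move=> d2 a0 ad; set W := invmx V; set v := fun k => row k V.
have W_unit : W \in unitmx by rewrite unitmx_inv.
have D_gt0 : 0 < `|\det V|.
  by rewrite normr_gt0; move: V_unit; rewrite unitmxE unitfE.
have D_int x k : integral x -> `|\det V| * co W x k \is a Num.int.
  exact: invmx_denominator.
have co_v k l : co W (v k) l = (k == l)%:R.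
  by rewrite /co /v -row_mul mulmxV // !mxE.
have coK x : x = \sum_k co W x k *: row k V.
  by rewrite -mulmx_sum_row mulmxKV.
have co_a k : co W (\sum_l a l *: v l) k = a k.
  rewrite co_sum (bigD1 k) //= co_v eqxx mulr1 big1 ?addr0 // => l /negPf lk.
  by rewrite co_v lk mulr0.
have xd : decreasing_nonneg W (\sum_l a l *: v l).
  by split=> [k|k l kl]; rewrite !co_a ?a0 ?ad.
have [g gP] := flag_basis_exists D_gt0 D_int V_int co_v.
suff [u [c [ub _ us [xu c0]]]] : covered_mod_flag W g 0 (cover_size d)%:R (\sum_l a l *: v l).
  exists u, c; split=> // [i|i]; first exact: c0.
  have [u0 uN] := us i isT.
  by exists (co W (u i)); split=> // k; apply: u0.
rewrite /cover_size; have [d2'|dn2] := eqVneq d 2%N.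
  rewrite -[2%:R]subr0.
  (* The stage bounds are 2, 1, 0, and [1 + 1/2 <= 2]. *)
  apply: (all_stages W_unit D_gt0 D_int co_v gP (b := fun j => 2 - j%:R)) => // [|j].
    by rewrite d2' subrr.
  have j1 : j%:R <= 1 :> R by rewrite lern1 -ltnS; move: (ltn_ord j); rewrite [in X in (_ < X)%N -> _]d2'.
  split; first exact: (sum_bound_plane d2' V_int co_v); first lra.
  have d2R : d%:R = 2 :> R by rewrite d2'.
  by have := ler0n R j; rewrite -natr1 d2R; lra.
have d3 : (3 <= d)%N by rewrite ltn_neqAle eq_sym dn2.
have d1 : 1 <= d%:R :> R by rewrite ler1n ltnW // ltnW.
pose K : R := 2 * d%:R + 1.
have K0 : 0 < K by rewrite /K; lra.
(* This satisfies [b (j+1) * (1 + 1/d) <= b j] because [(d+1)(j+1) <= d(j+2)] for [j < d]; moreover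
   [b j >= K] there, and [b 0 = K d]. *)
pose b j : R := if (j < d)%N then K * d%:R / j.+1%:R else 0.
have -> : ((2 * d + 1) * d)%:R = b 0%N.
  by rewrite /b (leq_trans _ d2) // divr1 /K natrM natrD natrM.
apply: (all_stages W_unit D_gt0 D_int co_v gP (b := b)) => // [|j].
  by rewrite /b ltnn.
have jd : j.+1%:R <= d%:R :> R by rewrite ler_nat ltn_ord.
have Kb : K <= b j by rewrite /b ltn_ord ler_pdivlMr // ler_wpM2l // ltW.
split; first exact: sum_bound_general Kb.
  by apply: le_trans Kb; rewrite /K; lra.
rewrite {1 2}/b; case: (ltnP j.+1 d) => jd1; last by rewrite mul0r addr0 (le_trans _ Kb) // ltW.
rewrite /b ltn_ord -[X in X + _]mulr1 -mulrDr -!mulrA ler_pM2l //.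
have -> : d%:R * (j.+2%:R^-1 * (1 + d%:R^-1)) = (d%:R + 1) / j.+2%:R :> R.
  by field; rewrite -natrD !pnatr_eq0 /= -lt0n (leq_trans _ d2).
rewrite ler_pdivrMr // mulrAC ler_pdivlMr // -[j.+2%:R]natr1; nra.
Qed.


End Simplicial.

(** * Cones spanned by a lattice basis *)

Lemma sum_codom (R : realType) d n (u : 'I_n -> 'rV[R]_d) (lam : 'I_(size (codom u)) -> R)
    (e : n = size (codom u)) :
  \sum_(i < size (codom u)) lam i *: (codom u)`_i = \sum_i lam (cast_ord e i) *: u i.
Proof.
rewrite (reindex (cast_ord e)) /=; last first.
  by exists (cast_ord (esym e)) => i _; rewrite ?cast_ordK ?cast_ordKV.
apply: eq_bigr => i _; congr (_ *: _).
by rewrite (nth_map i) ?size_enum_ord // nth_ord_enum.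
Qed.

Lemma size_codom_ord (R : realType) d n (u : 'I_n -> 'rV[R]_d) : n = size (codom u).
Proof. by rewrite size_codom card_ord. Qed.

Lemma cone_gen_codom (R : realType) d n (u : 'I_n -> 'rV[R]_d) x :
  cone_gen (codom u) x <->
  exists c : 'I_n -> R, (forall i, 0 <= c i) /\ x = \sum_i c i *: u i.
Proof.
have e := size_codom_ord u; split=> [[lam [l0 ->]]|[c [c0 ->]]].
  by exists (fun i => lam (cast_ord e i)); split=> //; apply: sum_codom.
exists (fun i => c (cast_ord (esym e) i)); split=> //.
by rewrite (sum_codom _ e); apply: eq_bigr => i _; rewrite cast_ordK.
Qed.

Section LatticeBasisCone.
Variables (R : realType) (d : nat) (u : 'I_d -> 'rV[R]_d).
Hypothesis ub : lattice_basis u.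
Implicit Types x y : 'rV[R]_d.

Let U : 'M[R]_d := \matrix_i u i.

Lemma lattice_basis_unitmx : U \in unitmx.
Proof.
have /fin_all_exists [a ha] := fun k => lattice_basis_span (delta_mx 0 k) ub.
apply: (proj2 (mulmx1_unit (A := \matrix_(k, i) a k i) (B := U) _)).
apply/row_matrixP => k; rewrite row_mul row1 ha mulmx_sum_row.
by apply: eq_bigr => i _; rewrite rowK !mxE.
Qed.

Let W := invmx U.
Local Notation cf := (co W).

Lemma cf_basis i k : cf (u i) k = (i == k)%:R.
Proof.
rewrite /co; have -> : u i = row i U by rewrite rowK.
by rewrite -row_mul mulmxV ?lattice_basis_unitmx // !mxE.
Qed.

Lemma cf_sum (c : 'I_d -> R) k : cf (\sum_i c i *: u i) k = c k.
Proof.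
rewrite co_sum (bigD1 k) //= cf_basis eqxx mulr1 big1 ?addr0 // => i /negPf ik.
by rewrite cf_basis ik mulr0.
Qed.

Lemma cfK x : x = \sum_i cf x i *: u i.
Proof. by have [a ->] := lattice_basis_span x ub; apply: eq_bigr => i _; rewrite cf_sum. Qed.

Lemma cf_inj x y : (forall k, cf x k = cf y k) -> x = y.
Proof. by move=> h; rewrite [x]cfK [y]cfK; apply: eq_bigr => i _; rewrite h. Qed.

Lemma cf_int x : integral x -> forall k, cf x k \is a Num.int.
Proof. by move=> /(proj2 ub) [a [ai ->]] k; rewrite cf_sum. Qed.

Definition basis_cone := cone_gen (codom u).

Lemma basis_coneP x : basis_cone x <-> forall k, 0 <= cf x k.
Proof.
rewrite /basis_cone cone_gen_codom; split=> [[c [c0 ->]] k|h]; first by rewrite cf_sum.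
by exists (cf x); split=> //; apply: cfK.
Qed.

Lemma ext_int_gen_basis i : ext_int_gen basis_cone (u i).
Proof.
have cu k : cf (u i) k = (i == k)%:R := cf_basis i k.
split; [split; [|split]|split].
- by apply/eqP => e; have := cu i; rewrite e co0 eqxx => /eqP; rewrite eq_sym oner_eq0.
- by apply/basis_coneP => k; rewrite cu.
- move=> x y /basis_coneP x0 /basis_coneP y0 [t [t0 xyt]].
  have xy k : i != k -> cf x k = 0 /\ cf y k = 0.
    move=> /negPf ik; have := coD W x y k; rewrite xyt coZ cu ik mulr0 => /esym/eqP.
    by rewrite paddr_eq0 // => /andP [/eqP -> /eqP ->].
  split; [exists (cf x i)|exists (cf y i)]; split=> //; apply: cf_inj => k;
    by rewrite coZ cu; case: eqVneq => [<-|/xy [ex ey]]; [rewrite mulr1|rewrite mulr0 ?ex ?ey].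
- exact: (proj1 ub).
move=> x [t [t0 xt]] /cf_int /(_ i); rewrite {1}xt coZ cu eqxx mulr1 => ti.
have : t \is a Num.nat by rewrite natrEint ti.
by case/natrP => k tk; exists k; rewrite xt tk.
Qed.

(** The [u i] are extreme integral generators and already generate all of the integer lattice. *)
Lemma unimodular_basis_cone : unimodular basis_cone.
Proof.
split; [split|split].
- exists (codom u); split=> // w /codomP [i ->].
  exists (map_mx (fun r : R => (Num.floor r)%:~R) (u i)).
  by apply/rowP => k; rewrite !mxE ratr_int floorK //; apply: (proj1 ub).
- move=> x /basis_coneP x0 /basis_coneP y0; apply: cf_inj => k.
  apply: le_anti; rewrite co0 x0 andbT; have := y0 k.
  by rewrite -scaleN1r coZ mulN1r oppr_ge0.
- exists (codom u); split=> //.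
  have e := size_codom_ord u.
  apply/(@freeP _ _ _ (in_tuple (codom u))) => k /=.
  rewrite (sum_codom _ e) => s0 i.
  by have := cf_sum (fun i => k (cast_ord e i)) (cast_ord (esym e) i); rewrite s0 co0 cast_ordKV.
move=> x /cf_int xi _; exists (codom u); split=> [w /codomP [i ->]|].
  exact: ext_int_gen_basis.
have e := size_codom_ord u.
exists (fun i => cf x (cast_ord (esym e) i)); split=> [i|]; first exact: xi.
by rewrite (sum_codom _ e) [LHS]cfK; apply: eq_bigr => i _; rewrite cast_ordK.
Qed.

Lemma cf_seq_sum (s : seq 'rV[R]_d) k : cf (\sum_(w <- s) w) k = \sum_(w <- s) cf w k.
Proof. by apply: (big_morph (fun x => cf x k)); [move=> x y; exact: coD|exact: co0]. Qed.

(** In a decomposition of [u i] into elements of [H], coordinates are nonnegative, so each summand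
    is dominated by [u i]; one with nonzero [i]-th coordinate, an integer at most 1, equals
    [u i]. *)
Lemma basis_subset_generating (H : 'rV[R]_d -> Prop) i : generates basis_cone H -> H (u i).
Proof.
move=> [HC Hgen]; have [uC [ui _]] := ext_int_gen_basis i.
have [s [sH us]] := Hgen _ (proj1 (proj2 uC)) ui.
have s0 w k : w \in s -> 0 <= cf w k by move=> /sH /HC [/basis_coneP h _].
have le_s w k : w \in s -> cf w k <= (i == k)%:R.
  move=> ws; rewrite -cf_basis us cf_seq_sum (big_rem w) //= lerDl big_seq.
  by apply: sumr_ge0 => y /mem_rem ys; apply: s0.
have [w ws wi] : exists2 w, w \in s & cf w i != 0.
  apply: contrapT => n; have := cf_basis i i; rewrite {1}us cf_seq_sum eqxx big_seq big1.
    by move/eqP; rewrite eq_sym oner_eq0.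
  by move=> w ws; apply/eqP; apply: contrapT => /negP h; apply: n; exists w.
suff -> : u i = w by apply: sH.
apply: cf_inj => k; rewrite cf_basis; apply: le_anti; rewrite le_s // andbT.
case: eqVneq => [<-|ik]; last exact: s0.
by rewrite int_gt0_ge1 ?lt_def ?wi ?s0 // cf_int //; case: (HC _ (sH _ ws)).
Qed.

(** Minimality is applied to the part of [H] consisting of basis vectors, which still generates. *)
Lemma hilbert_basis_cone H : hilbert_basis basis_cone H -> forall w, H w -> exists i, w = u i.
Proof.
move=> [_ [[HC Hgen] Hmin]] w Hw.
suff: (fun w => H w /\ exists i, w = u i) w by case.
apply: (Hmin (fun w => H w /\ exists i, w = u i)) => //; first by move=> y [].
split=> [y [/HC //]|x /basis_coneP x0 /cf_int xi].
have /fin_all_exists [n hn] : forall i, exists n : nat, cf x i = n%:R.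
  move=> i; have : cf x i \is a Num.nat by rewrite natrEint xi x0.
  by case/natrP => n; exists n.
exists (flatten [seq nseq (n i) (u i) | i <- enum 'I_d]); split.
  move=> y /flattenP [t /mapP [i _ ->]]; rewrite mem_nseq => /andP [_ /eqP ->].
  by split; [apply: basis_subset_generating|exists i].
rewrite big_flatten big_map big_enum /= [LHS]cfK; apply: eq_bigr => i _.
by rewrite hn big_nseq iter_addr_0 scaler_nat.
Qed.

End LatticeBasisCone.

(** * Comparison with the stated bound *)

Lemma cover_size_le_cone_bound (R : realType) d : (2 <= d)%N ->
  (cover_size d)%:R <= cone_bound R d.
Proof.
move=> d2; rewrite /cover_size /cone_bound; case: eqVneq => [->|dn2].
  by rewrite /= sqrtr1 ceil1 mul1r; have -> : 1 * 1%N%:Z - 2 = -1 :> int by []; rewrite exprN1; lra.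
have d3 : (3 <= d)%N by rewrite ltn_neqAle eq_sym dn2.
set m := Num.ceil _.
have m2 : 2 <= m.
  rewrite -[2]/(1 + 1) lezD1 ceil_gt_int -[X in X < _]sqrtr1 ltr_sqrt ?ltr1n ?ltr0n;
  by case: (d) d3 => [|[|]].
case: m m2 => // k k2; have {}k2 : (2 <= k)%N by [].
have kd : (2 + 2 <= k * d.-1)%N.
  by rewrite -[(2+2)%N]/(2 * 2)%N leq_mul //; case: (d) d3 => [|[|]].
have -> : k%:Z * d.-1%:Z - 2 = (k * d.-1 - 2)%N%:Z by rewrite -PoszM subzn // (leq_trans _ kd).
rewrite -exprnP.
(* For [d >= 3] the ceiling is at least 2 and the exponent at least 2; these crude estimates
   suffice. *)
have p94 : 9 / 4 <= (3 / 2 : R) ^+ (k * d.-1 - 2).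
  have -> : 9 / 4 = (3 / 2 : R) ^+ 2 by field.
  by rewrite ler_weXn2l ?leq_subRL //; [lra|rewrite (leq_trans _ kd)].
have kR : 2 <= k%:~R :> R by rewrite -pmulrn ler_nat.
have [dR dE] : 3 <= d%:R :> R /\ d.-1%:R = d%:R - 1 :> R.
  by rewrite ler_nat d3 -subn1 natrB // (leq_trans _ d3).
rewrite dE natrM natrD !natrM -[d.+1%:R]natr1 mulrDl.
move: (d%:R) (k%:~R) (_ ^+ _) dR kR p94 => x y z x3 y2 z94.
have A0 : 0 <= (x - 1) * (x * (x + 1) / 2) by nra.
have yz : 9 / 2 <= y * z by have : 0 <= (y - 2) * (z - 9 / 4); [rewrite mulr_ge0 ?subr_ge0|nra].
have -> : y * (x - 1) * (x * (x + 1) / 2) * z = (x - 1) * (x * (x + 1) / 2) * (y * z) by ring.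
apply: le_trans (ler_wpM2l A0 yz).
(* This is [9/2 * (x-1)x(x+1)/2 - (2x+1)x], expanded around 3 to make its sign visible. *)
have : 0 <= x * ((x - 3) * (9 / 4 * x + 19 / 4) + 11) by rewrite mulr_ge0 ?addr_ge0 ?mulr_ge0; lra.
lra.
Qed.

(** * Generators of rational cones *)

Section ConeGen.
Variables (R : realType) (d : nat).
Implicit Types (s t : seq 'rV[R]_d) (x y v : 'rV[R]_d).

Lemma cone_genD s x y : cone_gen s x -> cone_gen s y -> cone_gen s (x + y).
Proof.
move=> [a [a0 ->]] [b [b0 ->]]; exists (fun i => a i + b i); split=> [i|].
  by rewrite addr_ge0.
by rewrite -big_split; apply: eq_bigr => i _; rewrite scalerDl.
Qed.

Lemma cone_genZ s (r : R) x : 0 <= r -> cone_gen s x -> cone_gen s (r *: x).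
Proof.
move=> r0 [a [a0 ->]]; exists (fun i => r * a i); split=> [i|].
  by rewrite mulr_ge0.
by rewrite scaler_sumr; apply: eq_bigr => i _; rewrite scalerA.
Qed.

Lemma cone_gen0 s : cone_gen s 0.
Proof. by exists (fun=> 0); split=> //; rewrite big1 // => i _; rewrite scale0r. Qed.

Lemma cone_gen_mem s v : v \in s -> cone_gen s v.
Proof.
move=> vs; have vi : (index v s < size s)%N by rewrite index_mem.
exists (fun i => (i == Ordinal vi)%:R); split=> //.
rewrite (bigD1 (Ordinal vi)) //= eqxx scale1r nth_index // big1 ?addr0 //.
by move=> i /negPf ->; rewrite scale0r.
Qed.

Lemma cone_gen_sub s t x : (forall v, v \in s -> cone_gen t v) -> cone_gen s x -> cone_gen t x.
Proof.
move=> st [a [a0 ->]]; elim/big_ind: _; [exact: cone_gen0|by move=> *; apply: cone_genD|].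
by move=> i _; apply: cone_genZ => //; apply: st; apply: mem_nth.
Qed.

Lemma cone_gen_cons v s x :
  cone_gen (v :: s) x <-> exists a y, [/\ 0 <= a, cone_gen s y & x = a *: v + y].
Proof.
split=> [[a [a0 ->]]|[a [y [a0 ys ->]]]].
  rewrite big_ord_recl; exists (a ord0), (\sum_(i < size s) a (lift ord0 i) *: s`_i).
  by split=> //; exists (fun i => a (lift ord0 i)).
apply: cone_genD.
  by apply: cone_genZ => //; apply: cone_gen_mem; rewrite mem_head.
by apply: cone_gen_sub ys => w ws; apply: cone_gen_mem; rewrite in_cons ws orbT.
Qed.

Definition primitive v := [/\ v != 0, integral v &
  forall x, ray v x -> integral x -> exists k : nat, x = k%:R *: v].

Lemma rational_ray_integral v : rational_vec v ->
  exists2 N : R, 0 < N & integral (N *: v).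
Proof.
move=> [q ->]; exists (\prod_i (denq (q 0 i))%:~R).
  by apply: prodr_gt0 => i _; rewrite ltr0z denq_gt0.
move=> i; rewrite !mxE (bigD1 i) //= mulrAC rpredM //; last first.
  by rewrite rpred_prod // => k _; rewrite intr_int.
by rewrite /ratr mulrC divfK ?intr_int // intr_eq0 denq_neq0.
Qed.

Lemma primitive_multiple v : rational_vec v -> v != 0 ->
  exists2 t : R, 0 < t & primitive (t *: v).
Proof.
move=> vQ v0; have [N N0 Nv] := rational_ray_integral vQ.
have [i vi] : exists i, v 0 i != 0.
  apply: contrapT => n; move/eqP: v0; apply; apply/rowP => i; rewrite mxE.
  by apply/eqP; apply: contrapT => /negP h; apply: n; exists i.
have vi0 : 0 < `|v 0 i| by rewrite normr_gt0.
(* Integral positive multiples of [v] are measured by a nonzero coordinate, a natural number; the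
   least one is primitive by division with remainder. *)
pose P n := `[< exists t : R, [/\ 0 < t, integral (t *: v) & t * `|v 0 i| = n%:R] >].
have toP (t : R) : 0 < t -> integral (t *: v) -> exists2 n, P n & t * `|v 0 i| = n%:R.
  move=> t0 tv; have : t * `|v 0 i| \is a Num.nat.
    rewrite natrEint mulr_ge0 ?(ltW t0) // andbT -(gtr0_norm t0) -normrM.
    by have := tv i; rewrite mxE => h; case: ger0P; rewrite ?rpredN.
  by case/natrP => n e; exists n => //; apply/asboolP; exists t.
have exP : exists n, P n by have [n Pn _] := toP N N0 Nv; exists n.
case: (ex_minnP exP) => n /asboolP [t [t0 tv tn]] nmin.
exists t => //; split=> //; first by rewrite scaler_eq0 negb_or gt_eqF.
move=> x [r [r0 xr]] xi.
pose f : R := (Num.floor r)%:~R.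
have fi : f \is a Num.int by apply: intr_int.
have [fr rf] : f <= r /\ r < f + 1.
  by rewrite /f -[1]/(1%:~R) -intrD; split; [exact: floor_le|exact: floorD1_gt].
have f_r : f = r.
  apply/eqP; rewrite eq_le fr leNgt; apply/negP => fltr.
  have rv : integral (((r - f) * t) *: v).
    by rewrite -scalerA scalerBl -xr; apply: integralB => //; apply: integralZ.
  have [|k Pk ek] := toP _ _ rv; first by rewrite mulr_gt0 ?subr_gt0.
  have := nmin k Pk; rewrite -(ler_nat R) -ek -tn -mulrA ler_pMl ?mulr_gt0 //; lra.
have : f \is a Num.nat by rewrite natrEint fi f_r.
by case/natrP => k fk; exists k; rewrite xr -f_r fk.
Qed.

Lemma primitive_generators s : (forall v, v \in s -> rational_vec v) ->
  exists t, (forall v, v \in t -> primitive v) /\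
    forall x, cone_gen s x <-> cone_gen t x.
Proof.
elim: s => [|v s IH] sQ; first by exists [::].
have [|t [tp ts]] := IH; first by move=> w ws; apply: sQ; rewrite in_cons ws orbT.
have [v0|v0] := eqVneq v 0.
  exists t; split=> // x; rewrite -ts cone_gen_cons v0; split=> [[a [y [_ ys ->]]]|xs].
    by rewrite scaler0 add0r.
  by exists 0, x; rewrite scale0r add0r.
have [r r0 rp] := primitive_multiple (sQ v (mem_head _ _)) v0.
exists (r *: v :: t); split=> [w|x].
  by rewrite in_cons => /orP [/eqP -> //|/tp].
rewrite !cone_gen_cons; split=> [[a [y [a0 /ts yt ->]]]|[a [y [a0 /ts ys ->]]]].
  by exists (a / r), y; split=> //; [rewrite divr_ge0 // ltW|rewrite scalerA divfK ?gt_eqF].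
by exists (a * r), y; split=> //; [rewrite mulr_ge0 // ltW|rewrite scalerA].
Qed.

(** Take a primitive generating family of least size: a non-extreme member would be redundant. *)
Lemma ext_int_gen_generators (C : 'rV[R]_d -> Prop) : rat_cone C ->
  exists s, (forall v, v \in s -> ext_int_gen C v) /\ forall x, C x <-> cone_gen s x.
Proof.
move=> [[s0 [s0Q Cs0]] Cp].
pose P n := `[< exists s, [/\ size s = n, forall v, v \in s -> primitive v &
  forall x, C x <-> cone_gen s x] >].
have exP : exists n, P n.
  have [t [tp ts]] := primitive_generators s0Q; exists (size t); apply/asboolP; exists t.
  by split=> // x; rewrite Cs0 ts.
case: (ex_minnP exP) => n /asboolP [s [sn sp Cs]] nmin; exists s; split=> // v vs.
have [v0 vi vp] := sp v vs; split=> //; split=> //.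
have Cv : C v by apply/Cs; apply: cone_gen_mem.
split=> //; pose r := rem v s.
have Cr x : C x <-> cone_gen (v :: r) x.
  rewrite Cs; split; apply: cone_gen_sub => w ws; apply: cone_gen_mem.
    by rewrite -(perm_mem (perm_to_rem vs)).
  by rewrite (perm_mem (perm_to_rem vs)).
have rC x : cone_gen r x -> C x.
  by move=> h; apply/Cr/cone_gen_cons; exists 0, x; rewrite scale0r add0r.
have Cadd x y : C x -> C y -> C (x + y) by move=> /Cs h1 /Cs h2; apply/Cs; apply: cone_genD.
have Cmul a x : 0 <= a -> C x -> C (a *: x) by move=> a0 /Cs h; apply/Cs; apply: cone_genZ.
move=> x y /Cr/cone_gen_cons [a [x' [a0 x'r ->]]] /Cr/cone_gen_cons [b [y' [b0 y'r ->]]].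
move=> [t [t0 xyt]].
have e : x' + y' = (t - a - b) *: v.
  by rewrite !scalerBl -xyt; apply/rowP => i; rewrite !mxE; ring.
(* If positive, [v] would lie in the cone of the other generators, against minimality. If not,
   pointedness forces [x'] and [y'] to vanish. *)
have tab : t - a - b <= 0.
  rewrite leNgt; apply/negP => tab.
  have vr : cone_gen r v.
    have -> : v = (t - a - b)^-1 *: (x' + y') by rewrite e scalerA mulVf ?gt_eqF // scale1r.
    by apply: cone_genZ; [rewrite invr_ge0 ltW|apply: cone_genD].
  have : P (size r).
    apply/asboolP; exists r; split=> // [w /mem_rem /sp //|z].
    split=> [/Cr|/rC //]; apply: cone_gen_sub => w; rewrite in_cons => /orP [/eqP -> //|].
    exact: cone_gen_mem.
  move/nmin; rewrite -sn /r size_rem // leqNgt ltn_predL.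
  by case: (s) vs.
have zero u w : cone_gen r u -> cone_gen r w -> u + w = (t - a - b) *: v -> u = 0.
  move=> ur wr uw; apply: Cp; first exact: rC.
  have -> : - u = w + (- (t - a - b)) *: v.
    by rewrite scaleNr -uw; apply/rowP => i; rewrite !mxE; ring.
  by apply: Cadd; [exact: rC|apply: Cmul => //; rewrite oppr_ge0].
have -> : x' = 0 by apply: (zero x' y').
have -> : y' = 0 by apply: (zero y' x') => //; rewrite addrC.
by rewrite !addr0; split; [exists a|exists b].
Qed.

(** In a shortest subfamily, a linear relation with a positive coefficient could be subtracted until
    the first coefficient reaches 0, removing a generator. *)
Lemma caratheodory s x : cone_gen s x ->
  exists t, [/\ {subset t <= s}, free t & cone_gen t x].
Proof.
move=> sx; pose P n := `[< exists t, [/\ size t = n, {subset t <= s} & cone_gen t x] >].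
have exP : exists n, P n by exists (size s); apply/asboolP; exists s; split=> // v.
case: (ex_minnP exP) => n /asboolP [t [tn ts [a [a0 xa]]]] nmin.
exists t; split=> //; last by exists a.
apply/(@freeP _ _ _ (in_tuple t)) => /= k0 k0s i1; apply: contrapT => k0i.
have [k [ks [i ki]]] : exists k : 'I_(size t) -> R,
    \sum_i k i *: t`_i = 0 /\ exists i, 0 < k i.
  have [h|h] := ltP 0 (k0 i1); first by exists k0; split=> //; exists i1.
  exists (fun i => - k0 i); split.
    by under eq_bigr do rewrite scaleNr; rewrite sumrN k0s oppr0.
  by exists i1; rewrite oppr_gt0 lt_neqAle h andbT; apply/eqP.
pose F i := a i / k i.
case: (@Order.TotalTheory.arg_minP _ _ _ i (fun i => 0 < k i) F ki) => i2 ki2 i2min.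
pose r := F i2; pose b i := a i - r * k i.
have r0 : 0 <= r by rewrite divr_ge0 // ltW.
have b0 l : 0 <= b l.
  rewrite subr_ge0; case: (ltP 0 (k l)) => kl.
    by rewrite -ler_pdivlMr //; apply: i2min.
  by apply: le_trans (a0 l); rewrite mulr_ge0_le0.
have bi2 : b i2 = 0 by rewrite /b /r /F divfK ?subrr // gt_eqF.
have xb : x = \sum_i b i *: t`_i.
  under eq_bigr do rewrite scalerBl -scalerA.
  by rewrite sumrB -scaler_sumr ks scaler0 subr0.
have : P n.-1.
  apply/asboolP; exists [seq t`_l | l : 'I_(size t) in predC1 i2]; split.
  - by rewrite size_map -cardE cardC1 card_ord tn.
  - by move=> w /imageP [l _ ->]; apply: ts; apply: mem_nth.
  rewrite xb; elim/big_ind: _; [exact: cone_gen0|by move=> *; apply: cone_genD|].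
  move=> l _; have [->|li] := eqVneq l i2; first by rewrite bi2 scale0r; apply: cone_gen0.
  by apply: cone_genZ => //; apply: cone_gen_mem; apply: image_f.
by move/nmin; rewrite leqNgt ltn_predL -tn (leq_ltn_trans _ (ltn_ord i)).
Qed.

Lemma free_extension s t : free t -> exists t',
  [/\ free t', {subset t <= t'}, {subset t' <= t ++ s} & {subset s <= <<t'>>%VS}].
Proof.
elim: s t => [|v s IH] t tf; first by exists t; split=> // w; rewrite cats0.
have [vt|vt] := boolP (v \in <<t>>%VS).
  have [t' [f1 f2 f3 f4]] := IH t tf; exists t'; split=> // w.
    by move/f3; rewrite !mem_cat in_cons => /orP [] ->; rewrite ?orbT.
  rewrite in_cons => /orP [/eqP ->|/f4 //].
  by apply: subvP vt; apply: sub_span.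
have [|t' [f1 f2 f3 f4]] := IH (v :: t); first by rewrite free_cons vt.
exists t'; split=> // w.
- by move=> wt; apply: f2; rewrite in_cons wt orbT.
- by move/f3; rewrite !mem_cat !in_cons => /orP [/orP [] ->|->]; rewrite ?orbT.
rewrite in_cons => /orP [/eqP ->|/f4 //].
by apply: memv_span; apply: f2; rewrite mem_head.
Qed.

End ConeGen.

(** * The cover *)

Lemma decreasing_perm (R : realType) d (a : 'I_d -> R) :
  exists p : 'S_d, forall k l : 'I_d, (k <= l)%N -> a (p l) <= a (p k).
Proof.
pose leT (i j : 'I_d) := a j <= a i; pose s := sort leT (enum 'I_d).
have ss : size s = d by rewrite size_sort size_enum_ord.
have su : uniq s by rewrite sort_uniq enum_uniq.
have f_inj : injective (fun k : 'I_d => nth k s k).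
  move=> k l; rewrite (set_nth_default l k) ?ss // => /eqP.
  by rewrite nth_uniq ?ss // => /eqP /val_inj.
exists (perm f_inj) => k l kl; rewrite !permE (set_nth_default k l) ?ss //.
have tr : transitive leT by move=> y x z xy yz; apply: le_trans yz xy.
have rf : reflexive leT by move=> y; apply: lexx.
have srt : sorted leT s by apply: sort_sorted => x y; apply: le_total.
by apply: (sorted_leq_nth tr rf k srt); rewrite ?inE ?ss.
Qed.

Section Simplex.
Variables (R : realType) (d : nat).
Implicit Types (s : seq 'rV[R]_d) (x : 'rV[R]_d).

Lemma full_dim_simplex s x : full_dim (cone_gen s) -> cone_gen s x ->
  exists (V : 'M[R]_d) a, [/\ V \in unitmx, forall k, row k V \in s,
    forall k, 0 <= a k, forall k l : 'I_d, (k <= l)%N -> a l <= a k &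
    x = \sum_k a k *: row k V].
Proof.
move=> sfull sx; have [t0 [t0s t0f t0x]] := caratheodory sx.
(* The independent generators are completed to a basis of the whole space taken from [s], as the
   cone has full dimension. *)
have [t [tf t0t tts ts]] := free_extension s t0f.
have {}t0s : {subset t <= s}.
  by move=> w /tts; rewrite mem_cat => /orP [/t0s|].
have {t0x}[a [a0 xa]] : cone_gen t x.
  by apply: cone_gen_sub t0x => w /t0t; apply: cone_gen_mem.
have span_gen y : cone_gen s y -> y \in <<t>>%VS.
  move=> [c [_ ->]]; apply: rpred_sum => i _; rewrite rpredZ //; apply: ts.
  exact: mem_nth.
have e : d = size t.
  have tfull : <<t>>%VS = fullv.
    apply/eqP; rewrite eqEsubv subvf; apply/subvP => y _.
    by have [y1 [y2 [h1 [h2 ->]]]] := sfull y; rewrite rpredB ?span_gen.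
  by move: tf; rewrite /free tfull dimvf dim_matrix => /eqP; rewrite mul1r.
pose V0 : 'M[R]_d := \matrix_k t`_(cast_ord e k).
have V0u : V0 \in unitmx.
  rewrite -row_free_unit; apply: inj_row_free => u uV.
  apply/rowP => k; rewrite mxE.
  have /(@freeP _ _ _ (in_tuple t))/(_ (fun i => u 0 (cast_ord (esym e) i))) h := tf.
  rewrite -[k](cast_ordK e); apply: h; rewrite -[RHS]uV mulmx_sum_row.
  rewrite (reindex (cast_ord e)) /=; last first.
    by exists (cast_ord (esym e)) => i _; rewrite ?cast_ordK ?cast_ordKV.
  by apply: eq_bigr => i _; rewrite cast_ordK rowK.
have [p pa] := decreasing_perm (fun k => a (cast_ord e k)).
exists (row_perm p V0), (fun k => a (cast_ord e (p k))); split=> //.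
- by rewrite row_permE unitmx_mul unitmx_perm.
- move=> k; have -> : row k (row_perm p V0) = t`_(cast_ord e (p k)).
    by apply/rowP => i; rewrite !mxE.
  by apply: t0s; apply: mem_nth; apply: ltn_ord.
rewrite xa (reindex (cast_ord e)) /=; last first.
  by exists (cast_ord (esym e)) => i _; rewrite ?cast_ordK ?cast_ordKV.
rewrite (reindex_inj (@perm_inj _ p)) /=; apply: eq_bigr => k _; congr (_ *: _).
by apply/rowP => i; rewrite !mxE.
Qed.

Lemma dilate_Delta (C : 'rV[R]_d -> Prop) n (v : 'I_n -> 'rV[R]_d) (e : 'I_n -> R) (c : nat) :
  (0 < c)%N -> (forall k, ext_int_gen C (v k)) -> (forall k, 0 <= e k) ->
  \sum_k e k <= c%:R -> dilate c%:R (Delta C) (\sum_k e k *: v k).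
Proof.
move=> c0 vC e0 ec; have cR : 0 < c%:R :> R by rewrite ltr0n.
exists (\sum_k (e k / c%:R) *: v k); split; last first.
  rewrite scaler_sumr; apply: eq_bigr => k _.
  by rewrite scalerA mulrC divfK // gt_eqF.
have sz := size_codom_ord v.
exists (0 :: codom v); split=> [w|].
  by rewrite in_cons => /orP [/eqP ->|/codomP [k ->]]; [left|right].
(* The slack in the coefficient sum becomes the weight of the origin. *)
pose lam (i : 'I_(size (codom v)).+1) : R :=
  if unlift ord0 i is Some l then e (cast_ord (esym sz) l) / c%:R
  else 1 - (\sum_k e k) / c%:R.
have lam0 : lam ord0 = 1 - (\sum_k e k) / c%:R by rewrite /lam unlift_none.
have lamS (l : 'I_(size (codom v))) : lam (lift ord0 l) = e (cast_ord (esym sz) l) / c%:R by rewrite /lam liftK.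
exists lam; split=> [i|].
  rewrite /lam; case: unliftP => [l _|_]; first by rewrite divr_ge0 // ltW.
  by rewrite subr_ge0 ler_pdivrMr // mul1r.
split; last first.
  rewrite [RHS]big_ord_recl scaler0 add0r.
  transitivity (\sum_(l < size (codom v)) (e (cast_ord (esym sz) l) / c%:R) *: (codom v)`_l).
    by rewrite (sum_codom _ sz); apply: eq_bigr => k _; rewrite cast_ordK.
  by apply: eq_bigr => l _; rewrite -lamS.
transitivity (lam ord0 + \sum_(l < size (codom v)) lam (lift ord0 l)).
  exact: big_ord_recl.
rewrite lam0 (eq_bigr _ (fun l _ => lamS l)) (reindex (cast_ord sz)) /=; last first.
  by exists (cast_ord (esym sz)) => i _; rewrite ?cast_ordK ?cast_ordKV.
under [X in _ + X]eq_bigr do rewrite cast_ordK.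
by rewrite -mulr_suml subrK.
Qed.

(* The finite type of [f] indexes the integral matrices with entries in [-B, B]. *)
Definition decode (B : nat) (f : {ffun 'I_d * 'I_d -> 'I_(2 * B).+1}) (i : 'I_d) : 'rV[R]_d :=
  \row_k ((f (i, k))%:R - B%:R).

Lemma decode_surj (B : nat) (u : 'I_d -> 'rV[R]_d) : (forall i, integral (u i)) ->
  (forall i k, `|u i 0 k| <= B%:R) -> exists f, u = decode (B := B) f.
Proof.
move=> ui uB.
have /fin_all_exists [f fP] : forall ik : 'I_d * 'I_d, exists m : 'I_(2 * B).+1,
    u ik.1 0 ik.2 = m%:R - B%:R.
  move=> [i k] /=; have := uB i k; rewrite ler_norml => /andP [h1 h2].
  have : u i 0 k + B%:R \is a Num.nat.
    by rewrite natrEint rpredD ?ui ?rpred_nat //=; lra.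
  case/natrP => m mE; have mB : (m < (2 * B).+1)%N.
    by rewrite ltnS -(ler_nat R) -mE natrM; lra.
  by exists (Ordinal mB); rewrite /= -mE addrK.
exists [ffun ik => f ik]; apply/funext => i; apply/rowP => k.
by rewrite mxE ffunE -(fP (i, k)).
Qed.

Lemma cone_cover : (2 <= d)%N -> cone_cover_bound R d (cover_size d).
Proof.
move=> d2 C Crat Cfull; set c := cover_size d.
have c0 : (0 < c)%N by rewrite /c /cover_size; case: ifP => // _; rewrite muln_gt0 addn1 (ltnW d2).
have [s [sext Cs]] := ext_int_gen_generators Crat.
pose M : R := \sum_(w <- s) \sum_k `|w 0 k|.
have wM w k : w \in s -> `|w 0 k| <= M.
  move=> ws; rewrite /M (big_rem w) //= (bigD1 k) //= -addrA lerDl.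
  by rewrite addr_ge0 ?sumr_ge0 // => i _; rewrite sumr_ge0.
(* Combinations of generators with nonnegative coefficients of sum at most [c] have entries of
   absolute value at most [c * M]. *)
pose B := (Num.truncn (c%:R * M)).+1.
have BM : c%:R * M <= B%:R by rewrite ltW // truncnS_gt.
pose fits u := lattice_basis u /\ forall i, C (u i) /\ dilate c%:R (Delta C) (u i).
have sfull : full_dim (cone_gen s).
  by move=> x; have [y [z [/Cs hy [/Cs hz ->]]]] := Cfull x; exists y, z.
have covered x : C x -> exists f : {ffun 'I_d * 'I_d -> 'I_(2 * B).+1},
    fits (decode f) /\ basis_cone (decode f) x.
  move=> /Cs sx; have [V [a [Vu Vs a0 ad xa]]] := full_dim_simplex sfull sx.
  have Vext k : ext_int_gen C (row k V) by apply: sext.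
  have Vi k : integral (row k V) by case: (Vext k) => _ [].
  have [u [b [ub b0 xb ue]]] := simplicial_cover Vu Vi d2 a0 ad.
  have [|i k|f uf] := @decode_surj B u; first by case: ub.
    have [e [e0 ec ->]] := ue i; apply: le_trans BM; rewrite summxE.
    apply: le_trans (ler_norm_sum _ _ _) _.
    apply: (@le_trans _ _ (\sum_l e l * M)).
      apply: ler_sum => l _; rewrite mxE normrM (ger0_norm (e0 l)) ler_wpM2l //.
      exact: wM.
    rewrite -mulr_suml ler_wpM2r // // sumr_ge0 // => w _.
    by rewrite sumr_ge0.
  exists f; rewrite -uf; split; last first.
    by apply/cone_gen_codom; exists b; split=> //; rewrite xa.
  split=> // i; have [e [e0 ec ->]] := ue i; split; last by apply: dilate_Delta.
  apply/Cs; elim/big_ind: _; [exact: cone_gen0|by move=> *; apply: cone_genD|].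
  by move=> k _; apply: cone_genZ => //; apply: cone_gen_mem.
(* The cover consists of the cones of all bases in this finite range that fit, whichever points they
   serve. *)
pose P : pred {ffun 'I_d * 'I_d -> 'I_(2 * B).+1} := fun f => `[< fits (decode f) >].
have fitsP (j : 'I_#|P|) : fits (decode (enum_val j)).
  by apply/asboolP; have := enum_valP j.
exists #|P|, (fun j => basis_cone (decode (enum_val j))); split=> [j|].
  by apply: unimodular_basis_cone; case: (fitsP j).
split=> [x|j H HH w Hw].
  split=> [/covered [f [ff fx]]|[j jx]].
    have fP : f \in P by apply/asboolP.
    by exists (enum_rank_in fP f); rewrite enum_rankK_in.
  apply/Cs; apply: cone_gen_sub jx => w /codomP [i ->]; apply/Cs.
  by case: (fitsP j) => _ /(_ i) [].
have [jb jD] := fitsP j; have [i ->] := hilbert_basis_cone jb HH Hw.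
by case: (jD i).
Qed.

End Simplex.

Unset Implicit Arguments.

Theorem theorem1p2 (R : realType) (d : nat) (hd : (2 <= d)%N) :
  exists c : nat, (c%:R <= cone_bound R d) /\ cone_cover_bound R d c.
Proof.
by exists (cover_size d); split; [exact: cover_size_le_cone_bound|exact: cone_cover].
Qed.
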